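(* Suppose that $\mathrm{zer}(\Phi)\neq\emptyset$, $F$ is $L$-Lipschitz continuous, and $\Phi$ is $\rho$-co-hypomonotone with $2L\rho<1$. Let $r>2$, and let $\beta,\eta$ satisfy $2\rho<\beta<\eta<\frac1L$. Put $\hat\phi:=\frac{1-L^2\eta^2}{2L^2\eta^2}>0$, $\omega:=\frac{\eta-\beta}2>0$, and $t_k:=k+t_0$, where $t_0$ is the constant defined in the context. Let $\{(x^k,y^k)\}$ be generated by the scheme (AEG) described in the context with these parameters. If, additionally, $T$ is closed (i.e. $\mathrm{gra}(T)$ is closed; in particular, if $T$ is maximally monotone), then both $\{x^k\}$ and $\{y^k\}$ converge to a point $x^\star\in\mathrm{zer}(\Phi)$.
   Context: $\mathbb R^p$ carries the standard inner product and Euclidean norm. $F:\mathbb R^p\to\mathbb R^p$ is single-valued, $T:\mathbb R^p\rightrightarrows2^{\mathbb R^p}$ is set-valued, $\Phi:=F+T$, $\mathrm{zer}(\Phi)=\{x:0\in Fx+Tx\}$. For $\rho\ge0$, $\Phi$ is $\rho$-co-hypomonotone if $\langle u-v,x-y\rangle\ge-\rho\|u-v\|^2$ for all $(x,u),(y,v)\in\mathrm{gra}(\Phi)$. $F$ is $L$-Lipschitz continuous if $\|Fx-Fy\|\le L\|x-y\|$ for all $x,y$. The resolvent $J_{\eta T}$, $J_{\eta T}x=\{y:x\in y+\eta Ty\}$, is assumed to be defined on all of $\mathbb R^p$ and single-valued. Scheme (AEG): start from $x^0\in\mathrm{dom}(\Phi)$, $\xi^0\in Tx^0$, $y^{-1}=y^0:=x^0$.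 With $\xi^k\in Tx^k$ put $w^k:=Fx^k+\xi^k$ and $\hat w^k:=Fy^{k-1}+\xi^k$. For $k\ge0$: $$d^k:=\hat w^{k+1}-\gamma_kw^k,\qquad x^{k+1}:=y^k-\eta d^k,\qquad y^{k+1}:=x^{k+1}+\theta_k(x^{k+1}-x^k)-\eta_kw^{k+1}+\lambda_k\hat w^{k+1}-\nu_kw^k,$$ where the implicit definition of $x^{k+1}$ means $x^{k+1}=J_{\eta T}(y^k-\eta Fy^k+\eta\gamma_kw^k)$ and $\xi^{k+1}:=\frac1\eta(y^k-\eta Fy^k+\eta\gamma_kw^k-x^{k+1})\in Tx^{k+1}$. Parameters (the general parameter $\mu$ of the paper is set to $\mu:=1$): $t_{k+1}=t_k+1$ and $$\theta_k:=\frac{t_k-r-1}{t_{k+1}},\quad\gamma_k:=\frac{t_k-r+1}{t_k},\quad\eta_k:=\frac{(\eta-\beta)t_k-\delta}{t_{k+1}},\quad\lambda_k:=\frac{\eta t_k}{t_{k+1}},\quad\nu_k:=\frac{\beta t_k}{t_{k+1}},\quad\delta:=(r-1)\beta+\frac{(r-2)(\eta-\beta)}2.$$ Constants (with $\mu=1$): $$\Gamma:=\frac{(r-2)^2\eta^2+(4r-6)\eta\beta-(r^2-2)\beta^2}{4},\qquad\hat\Gamma:=\frac{2\Gamma}{r-2}+4\rho\omega r,$$ $$t_0:=\max\Big\{\frac{r+1}2+\frac{\eta}{2\hat\phi\omega},\ \frac{\hat\Gamma}{(\eta-\beta)^2},\ \frac{4\rho[\eta-\omega(r+1)]}{\omega(\beta-2\rho)},\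 \frac{\eta(r-1)}{\eta-\beta}\Big\}.$$ *)

(* Defs.v *)
From HB Require Import structures.
From mathcomp Require Import all_boot all_order all_algebra.
From mathcomp Require Import all_classical all_reals all_analysis.
From mathcomp Require Import lra.

Set Implicit Arguments.
Unset Strict Implicit.
Unset Printing Implicit Defensive.

Import Order.TTheory GRing.Theory Num.Theory.
Import numFieldNormedType.Exports.

Local Open Scope classical_set_scope.
Local Open Scope ring_scope.

(* The library norm on 'rV[R]_p is the sup norm; the Euclidean structure has to
   be defined.  Both norms induce the topology that the library puts on
   'rV[R]_p, so limits and closed sets below are the usual ones. *)
Definition dotp (R : realType) (p : nat) (u v : 'rV[R]_p) : R :=
  \sum_(i < p) u 0 i * v 0 i.

Definition enorm (R : realType) (p : nat) (u : 'rV[R]_p) : R :=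
  Num.sqrt (dotp u u).

Definition lipschitz_euclid (R : realType) (p : nat) (L : R)
    (F : 'rV[R]_p -> 'rV[R]_p) : Prop :=
  forall x y, enorm (F x - F y) <= L * enorm (x - y).

(* A set-valued operator maps each point to the set of its values. *)
Definition setop (R : realType) (p : nat) : Type :=
  'rV[R]_p -> set 'rV[R]_p.

Definition gra (R : realType) (p : nat) (T : setop R p) :
    set ('rV[R]_p * 'rV[R]_p) :=
  [set xu | T xu.1 xu.2].

Definition dom (R : realType) (p : nat) (T : setop R p) : set 'rV[R]_p :=
  [set x | T x !=set0].

Definition zer (R : realType) (p : nat) (T : setop R p) : set 'rV[R]_p :=
  [set x | T x 0].

Definition sumop (R : realType) (p : nat) (F : 'rV[R]_p -> 'rV[R]_p)
    (T : setop R p) : setop R p :=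
  fun x => [set F x + v | v in T x].

Definition co_hypomonotone (R : realType) (p : nat) (rho : R)
    (T : setop R p) : Prop :=
  forall x u y v, gra T (x, u) -> gra T (y, v) ->
    - rho * enorm (u - v) ^+ 2 <= dotp (u - v) (x - y).

Definition monotone_op (R : realType) (p : nat) (T : setop R p) : Prop :=
  forall x u y v, gra T (x, u) -> gra T (y, v) ->
    0 <= dotp (u - v) (x - y).

Definition maximally_monotone (R : realType) (p : nat) (T : setop R p) : Prop :=
  monotone_op T /\
  forall S : setop R p, monotone_op S -> gra T `<=` gra S -> gra S = gra T.

Definition resolvent (R : realType) (p : nat) (eta : R) (T : setop R p) :
    setop R p :=
  fun x => [set y | exists2 v, T y v & x = y + eta *: v].

Definition single_valued_everywhere (R : realType) (p : nat)
    (J : setop R p) : Prop :=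
  forall x, exists y, J x = [set y].

Section Constants.
Context {R : realType}.
Implicit Types L rho r beta eta : R.

Definition phihat L eta : R :=
  (1 - L ^+ 2 * eta ^+ 2) / (2 * L ^+ 2 * eta ^+ 2).

Definition omega beta eta : R := (eta - beta) / 2.

Definition Gamma_ r beta eta : R :=
  ((r - 2) ^+ 2 * eta ^+ 2 + (4 * r - 6) * eta * beta
     - (r ^+ 2 - 2) * beta ^+ 2) / 4.

Definition Gammahat rho r beta eta : R :=
  2 * Gamma_ r beta eta / (r - 2) + 4 * rho * omega beta eta * r.

Definition t_init L rho r beta eta : R :=
  let om := omega beta eta in
  Num.max ((r + 1) / 2 + eta / (2 * phihat L eta * om))
 (Num.max (Gammahat rho r beta eta / (eta - beta) ^+ 2)
 (Num.max (4 * rho * (eta - om * (r + 1)) / (om * (beta - 2 * rho)))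
          (eta * (r - 1) / (eta - beta)))).

Definition tseq L rho r beta eta : nat -> R :=
  fun k => k%:R + t_init L rho r beta eta.

Definition delta_ r beta eta : R :=
  (r - 1) * beta + (r - 2) * (eta - beta) / 2.

End Constants.

Section Scheme.
Context {R : realType} {p : nat}.
Context (F : 'rV[R]_p -> 'rV[R]_p) (T : setop R p).
Context (r beta eta : R) (t : nat -> R).

Definition theta_ (k : nat) : R := (t k - r - 1) / t k.+1.
Definition gamma_ (k : nat) : R := (t k - r + 1) / t k.
Definition eta_ (k : nat) : R :=
  ((eta - beta) * t k - delta_ r beta eta) / t k.+1.
Definition lambda_ (k : nat) : R := eta * t k / t k.+1.
Definition nu_ (k : nat) : R := beta * t k / t k.+1.

Definition w_ (x xi : nat -> 'rV[R]_p) (k : nat) : 'rV[R]_p :=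
  F (x k) + xi k.

(* The truncated predecessor gives [y 0] for index 0, i.e. y^{-1} = y^0. *)
Definition what_ (y xi : nat -> 'rV[R]_p) (k : nat) : 'rV[R]_p :=
  F (y k.-1) + xi k.

Definition d_ (x y xi : nat -> 'rV[R]_p) (k : nat) : 'rV[R]_p :=
  what_ y xi k.+1 - gamma_ k *: w_ x xi k.

Definition prox_arg (x y xi : nat -> 'rV[R]_p) (k : nat) : 'rV[R]_p :=
  y k - eta *: F (y k) + (eta * gamma_ k) *: w_ x xi k.

(* The update x^{k+1} = y^k - eta d^k is implicit, since d^k involves xi^{k+1};
   it is read through the resolvent, and recovered in [AEG_xE] below. *)
Record AEG (x y xi : nat -> 'rV[R]_p) : Prop := {
  AEG_dom : dom (sumop F T) (x 0%N) ;
  AEG_xi0 : T (x 0%N) (xi 0%N) ;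
  AEG_y0 : y 0%N = x 0%N ;
  AEG_x : forall k, resolvent eta T (prox_arg x y xi k) (x k.+1) ;
  AEG_xi : forall k, xi k.+1 = eta^-1 *: (prox_arg x y xi k - x k.+1) ;
  AEG_y : forall k, y k.+1 =
    x k.+1 + theta_ k *: (x k.+1 - x k) - eta_ k *: w_ x xi k.+1
      + lambda_ k *: what_ y xi k.+1 - nu_ k *: w_ x xi k
}.

Lemma AEG_xiP (x y xi : nat -> 'rV[R]_p) :
  eta != 0 -> AEG x y xi -> forall k, T (x k) (xi k).
Proof.
move=> eta0 H [|k]; first exact: (AEG_xi0 H).
have [v Tv E] := AEG_x H k.
by rewrite (AEG_xi H) E [_ + _ *: v]addrC addrK scalerA mulVf // scale1r.
Qed.

Lemma AEG_xE (x y xi : nat -> 'rV[R]_p) :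
  eta != 0 -> AEG x y xi -> forall k, x k.+1 = y k - eta *: d_ x y xi k.
Proof.
move=> eta0 H k; rewrite /d_ /what_ /= (AEG_xi H) scalerBr scalerDr !scalerA.
rewrite mulfV // scale1r /prox_arg.
set a := eta *: F _; set b := (_ * _) *: _; set c := y k.
by apply/rowP => i; rewrite !mxE; lra.
Qed.

End Scheme.

(* Main.v *)
Require Import Defs.
From mathcomp Require Import all_boot all_order all_algebra.
From mathcomp Require Import all_classical all_reals all_analysis.
From mathcomp Require Import ring lra.

Import Order.TTheory GRing.Theory Num.Theory.
Import numFieldNormedType.Exports.

Local Open Scope classical_set_scope.
Local Open Scope ring_scope.

(** Put [w k = F (x k) + xi k], an element of [Phi (x k)], and let [h k] be the
    error [what k.+1 - w k.+1] committed by evaluating [F] at [y k] instead of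
    [x k.+1].  With [om = (eta - beta) / 2] and the velocity
      [V k = t k (x k.+1 - x k + eta what k.+1 - beta w k)],
    eliminating [y] turns the scheme into the one-step relation
      [V k.+1 = V k - (r + 1) (x k.+1 - x k) - (r - 2) om (w k.+1)]
    ([AEG_velocity_step]).  For a zero [z] of [Phi] and [e = x - z], consider
      [energy = |V + r e|^2 + r |e|^2 - 2 om t <V, w> + 2 om^2 t^2 |w|^2].

    Its increment is a quadratic form in [x k.+1 - x k], [w k.+1],
    [w k.+1 - w k] and [h k], plus a negative multiple of
    [<w k.+1, x k.+1 - z>] ([energy_step]).  The weight [om] of the cross
    term [<V, w>] is the one for which the indefinite products
    [t <x k.+1 - x k, w k.+1>] cancel.  Co-hypomonotonicity between consecutive
    iterates, with [2 rho < beta], makes the [t^2 |w k.+1 - w k|^2] part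
    negative, and the Lipschitz bound on [h], with [L eta < 1], makes the
    [t^2 |h|^2] part negative; all the other terms are of lower order in [t].
    As [t k] tends to infinity, the energy eventually decreases by a multiple
    of [t |x k.+1 - x k|^2 + t |w k.+1|^2 + t^2 |w k.+1 - w k|^2 + t^2 |h|^2]
    and of the gap in the co-hypomonotonicity inequality at [z]
    ([energy_descent]).

    Each real sequence whose increments are bounded by decrements of the energy,
    or of any other convergent sequence, converges
    ([dominated_increments_cvg]).  This applies to
    [(r + 1) |e|^2 + 2 <V, e>], which differs by a convergent sequence from
    [(r + 1) q + t (q' - q)], where [q] is [|e|^2] corrected by the partial sums
    of a convergent series and [q'] is the next term of [q].  Convergence of
    such a combination forces that of [q] ([euler_average_cvg]), so [|x k - z|]
    converges for every zero [z].

    Opial's argument concludes: [w] tends to 0 and the graph of [T] is closed,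
    so the cluster points of [x] are zeros of [Phi] ([cluster_zero]), and a
    bounded sequence whose distance to each of its cluster points converges has
    a limit ([opial]).  Finally [y k - x k.+1] is a combination of
    [w k.+1 - w k], [h k] and [w k], so [y] has the same limit. *)

(** * Euclidean inner product *)

Section EuclideanSpace.
Context {R : realType} {p : nat}.
Implicit Types (u v w : 'rV[R]_p) (a : R).

Lemma dotpC u v : dotp u v = dotp v u.
Proof. by apply: eq_bigr => i _; rewrite mulrC. Qed.

Lemma dotpDl u v w : dotp (u + v) w = dotp u w + dotp v w.
Proof. by rewrite -big_split; apply: eq_bigr => i _; rewrite mxE mulrDl. Qed.

Lemma dotpZl a u v : dotp (a *: u) v = a * dotp u v.
Proof. by rewrite mulr_sumr; apply: eq_bigr => i _; rewrite mxE mulrA. Qed.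

Lemma dotpNl u v : dotp (- u) v = - dotp u v.
Proof. by rewrite -scaleN1r dotpZl mulN1r. Qed.

Lemma dotpDr u v w : dotp u (v + w) = dotp u v + dotp u w.
Proof. by rewrite dotpC dotpDl !(dotpC _ u). Qed.

Lemma dotpZr a u v : dotp u (a *: v) = a * dotp u v.
Proof. by rewrite dotpC dotpZl dotpC. Qed.

Lemma dotpNr u v : dotp u (- v) = - dotp u v.
Proof. by rewrite dotpC dotpNl dotpC. Qed.

Definition dotpE := (dotpDl, dotpDr, dotpNl, dotpNr, dotpZl, dotpZr).

Lemma dotp_ge0 u : 0 <= dotp u u.
Proof. by apply: sumr_ge0 => i _; rewrite -expr2 sqr_ge0. Qed.

Lemma enorm_sqr u : enorm u ^+ 2 = dotp u u.
Proof. by rewrite sqr_sqrtr ?dotp_ge0. Qed.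

Lemma young u v a : 0 < a -> 2 * dotp u v <= a * dotp u u + a^-1 * dotp v v.
Proof.
move=> a0.
have := mulr_ge0 (ltW a0) (dotp_ge0 (u - a^-1 *: v)).
have -> : a * dotp (u - a^-1 *: v) (u - a^-1 *: v)
        = a * dotp u u + a^-1 * dotp v v - 2 * dotp u v.
  by rewrite !dotpE (dotpC v u); field; rewrite gt_eqF.
by rewrite subr_ge0.
Qed.

Lemma young_norm u v a : 0 < a ->
  2 * `|dotp u v| <= a * dotp u u + a^-1 * dotp v v.
Proof.
move=> a0; case: (ger0P (dotp u v)) => _; first exact: young.
by rewrite -dotpNr; have := young u (- v) a a0; rewrite dotpNl !dotpNr opprK.
Qed.

End EuclideanSpace.

(** * The energy and its decrease along one step *)

Section Energy.
Context {R : realType} {p : nat}.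
Variables (r om : R).
Implicit Types (e w V D U q g h : 'rV[R]_p).

Definition energy (t : R) e w V : R :=
  dotp (V + r *: e) (V + r *: e) + r * dotp e e
  - 2 * om * t * dotp V w + 2 * om ^+ 2 * t ^+ 2 * dotp w w.

(** Completing the square in [V + r e - om t w] leaves
    [om t (2 r <w, e> + om t |w|^2)], which is nonnegative for large [t] because
    [<w, e>] is at least [- rho |w|^2]. *)
Lemma energy_ge (rho t : R) e w V :
    0 < om -> 0 <= r -> 0 <= t -> 2 * r * rho <= om * t ->
    - rho * dotp w w <= dotp w e ->
  r * dotp e e <= energy t e w V.
Proof.
move=> om0 r0 t0 ht hm.
have H := dotp_ge0 (V + r *: e - (om * t) *: w).
have -> : energy t e w V =
    dotp (V + r *: e - (om * t) *: w) (V + r *: e - (om * t) *: w)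
    + r * dotp e e + om * t * (2 * r * dotp w e + om * t * dotp w w).
  by rewrite /energy !dotpE (dotpC e w) (dotpC e V) (dotpC w V); ring.
suff : 0 <= om * t * (2 * r * dotp w e + om * t * dotp w w).
  by move: H; lra.
apply: mulr_ge0; first by rewrite mulr_ge0 // ltW.
have := ler_wpM2l r0 hm; have := ler_wpM2r (dotp_ge0 w) ht; lra.
Qed.

Variable (beta : R).
Let c := (r - 2) * om.
Let eta := beta + 2 * om.

(** Here [D] is the displacement of the iterate, [q] the new value of [w], [g]
    its variation and [h] the forward error.  There is no term [t <D, q>]: the
    contributions of [|V + r e|^2 + r |e|^2] and of [- 2 om t <V, w>] to it
    cancel. *)
Lemma energy_step t e D q g h :
  let V := t *: (D + ((2 * om) *: q + beta *: g + eta *: h)) in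
  energy (t + 1) (e + D) q (V - (r + 1) *: D - c *: q) - energy t e (q - g) V
  = - (2 * t - r - 1) * dotp D D - 2 * c * r * dotp q (e + D)
    + (c ^+ 2 - 2 * om * c * t + 2 * om * c + 2 * om ^+ 2) * dotp q q
    + 2 * (c + om) * (r + 1) * dotp D q
    - (2 * t * beta + 2 * om * t ^+ 2) * dotp g D
    - 2 * t * eta * dotp D h
    - 2 * t * (c + om) * (beta * dotp q g + eta * dotp q h)
    - 2 * om * t ^+ 2 * (om + beta) * dotp g g
    - 2 * om * eta * t ^+ 2 * dotp g h.
Proof.
rewrite /energy /= !dotpE.
rewrite (dotpC D e) (dotpC q e) (dotpC g e) (dotpC h e) (dotpC q D) (dotpC g D)
  (dotpC h D) (dotpC g q) (dotpC h q) (dotpC h g).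
rewrite /eta /c; ring.
Qed.

(** Up to sign, [- (r + 1) |e|^2 - 2 <V, e>] is the derivative in [s] of
    [|V + s e|^2 + s (r + 1 - s) |e|^2], the family whose member [s = r] occurs
    in the energy.  As for the whole family, the terms [<e, D>] of its
    increment cancel, and [e] survives only in [<q, e + D>]. *)
Lemma cross_term_step t e D q g h :
  let V := t *: (D + ((2 * om) *: q + beta *: g + eta *: h)) in
  (- (r + 1) * dotp (e + D) (e + D)
     - 2 * dotp (V - (r + 1) *: D - c *: q) (e + D))
  - (- (r + 1) * dotp e e - 2 * dotp V e)
  = (r + 1) * dotp D D - 2 * t * dotp D D
    - 2 * om * (t * (2 * dotp D q)) - beta * (t * (2 * dotp D g))
    - eta * (t * (2 * dotp D h)) + 2 * c * dotp q (e + D).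
Proof.
rewrite /= !dotpE (dotpC q D) (dotpC g D) (dotpC h D) (dotpC D e); ring.
Qed.

Lemma correction_step e D q g h :
  2 * dotp e ((2 * om) *: q + beta *: g + eta *: h)
  = 4 * om * dotp q (e + D) - 4 * om * dotp D q
    + beta * (2 * dotp e g) + eta * (2 * dotp e h).
Proof. rewrite !dotpE (dotpC q e) (dotpC q D); ring. Qed.

(** Rewrites the cross term as [(r + 1) Q + t (Q' - Q)] for the corrected
    squared distance [Q = |e|^2 + s], the correction [s] growing by
    [2 <e, U>]. *)
Lemma averaged_distance t s e D U :
  (r + 1) * (dotp e e + s)
    + t * (dotp (e + D) (e + D) + (s + 2 * dotp e U) - (dotp e e + s))
  = (r + 1) * s + t * dotp D D
    - (- (r + 1) * dotp e e - 2 * dotp (t *: (D + U)) e).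
Proof. rewrite !dotpE (dotpC D e) (dotpC U e); ring. Qed.

Definition dissip (t : R) D q g h : R :=
  t * dotp D D + t * dotp q q + t ^+ 2 * dotp g g + t ^+ 2 * dotp h h.


(** The argument of the Lipschitz bound is [g + h] up to the vanishing
    multiple [tau (q - g)] of the old value of [w]; enlarging the constant from
    [l] to [l'] pays for separating the two. *)
Lemma perturbed_lipschitz (l l' tau : R) (q g h : 'rV[R]_p) :
    0 < l -> l < l' ->
    dotp h h <= l * dotp (g + h + tau *: (q - g)) (g + h + tau *: (q - g)) ->
  dotp h h <= l' * dotp (g + h) (g + h)
    + 2 * (l + l ^+ 2 / (l' - l)) * tau ^+ 2 * (dotp q q + dotp g g).
Proof.
move=> l0 ll' hh.
have Z : dotp (q - g) (q - g) <= 2 * (dotp q q + dotp g g).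
  have := dotp_ge0 (q + g); rewrite !dotpE (dotpC g q); lra.
apply: (le_trans hh); move: {hh} Z; move: (g + h) (q - g) => u v Z.
have z0 : 0 < (l' - l) / l by rewrite divr_gt0 // subr_gt0.
have Y := young u (tau *: v) ((l' - l) / l) z0.
have -> : dotp (u + tau *: v) (u + tau *: v)
    = dotp u u + 2 * dotp u (tau *: v) + tau ^+ 2 * dotp v v.
  by rewrite !dotpE (dotpC v u); ring.
have {}Y : l * (2 * dotp u (tau *: v))
    <= (l' - l) * dotp u u + l ^+ 2 / (l' - l) * tau ^+ 2 * dotp v v.
  have -> : (l' - l) * dotp u u + l ^+ 2 / (l' - l) * tau ^+ 2 * dotp v v
      = l * ((l' - l) / l * dotp u u
             + ((l' - l) / l)^-1 * dotp (tau *: v) (tau *: v)).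
    by rewrite !dotpE; field; rewrite !gt_eqF // subr_gt0.
  by rewrite ler_pM2l.
have m0 : 0 <= (l + l ^+ 2 / (l' - l)) * tau ^+ 2.
  rewrite mulr_ge0 ?sqr_ge0 // addr_ge0 ?ltW //.
  by rewrite divr_gt0 ?exprn_gt0 ?subr_gt0.
have := ler_wpM2l m0 Z.
lra.
Qed.

(** The coefficient of [|g|^2] is [- om (beta - 2 rho) t^2], up to [O (t)], once
    the products [<g, D>] and [<g, h>] have been bounded.  The former is handled
    by co-hypomonotonicity; for the latter, the Lipschitz bound scaled by
    [om eta t^2 / l'] gives
    [- 2 om eta t^2 <g, h> <= om eta t^2 (|g|^2 + |h|^2 - |h|^2 / l')] up to
    bounded multiples of [|q|^2] and [|g|^2], which also leaves a negative
    multiple of [t^2 |h|^2].  Young's inequality distributes the remaining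
    products over the four squares, where they are dominated for large [t]. *)
Lemma energy_descent (rho l : R) :
    0 < om -> 0 <= rho -> 2 * rho < beta -> 2 < r -> 0 < l < 1 ->
  exists2 eps : R, 0 < eps & \forall t \near +oo, forall e D q g h,
    - rho * dotp g g <= dotp g D -> - rho * dotp q q <= dotp q (e + D) ->
    dotp h h <= l * dotp (g + h + ((r - 1) / t) *: (q - g))
                         (g + h + ((r - 1) / t) *: (q - g)) ->
    let V := t *: (D + ((2 * om) *: q + beta *: g + eta *: h)) in
    energy (t + 1) (e + D) q (V - (r + 1) *: D - c *: q)
    <= energy t e (q - g) V
       - eps * (dissip t D q g h + (dotp q (e + D) + rho * dotp q q)).
Proof.
move=> om0 rho0 hbeta hr /andP[l0 l1].
have beta0 : 0 < beta by lra.
have c0 : 0 < c by rewrite /c mulr_gt0 // subr_gt0.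
have eta0 : 0 < eta by rewrite /eta; lra.
(* Any constant strictly between [l] and 1 works. *)
pose l' := (1 + l) / 2.
have l'0 : 0 < l' by rewrite /l'; lra.
have l'1 : l' < 1 by rewrite /l'; lra.
have ll' : l < l' by rewrite /l'; lra.
pose a4 := om * eta * (l'^-1 - 1).
have a40 : 0 < a4 by rewrite /a4 !mulr_gt0 // subr_gt0 invf_gt1.
have a20 : 0 < om * c by rewrite mulr_gt0.
have a30 : 0 < om * (beta - 2 * rho) by rewrite mulr_gt0 // subr_gt0.
have a50 : 0 < 2 * c * r by rewrite !mulr_gt0 //; lra.
(* [m] is the smallest leading coefficient; half of it is kept as [eps], the
   other half dominates the lower order coefficients [K0], ..., [K4]. *)
pose m := Num.min 1 (Num.min (om * c) (Num.min (om * (beta - 2 * rho))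
                    (Num.min a4 (2 * c * r)))).
have m0 : 0 < m by rewrite /m !lt_min ltr01 a20 a30 a40 a50.
have [m1 [m2 [m3 [m4 m5]]]] : m <= 1 /\ m <= om * c /\
    m <= om * (beta - 2 * rho) /\ m <= a4 /\ m <= 2 * c * r.
  by rewrite /m !ge_min !lexx !orbT.
pose eps := m / 2; have eps0 : 0 < eps by rewrite divr_gt0.
have mE : m = 2 * eps by rewrite /eps; lra.
rewrite {}mE {m0} in m1 m2 m3 m4 m5.
pose K0 := om * eta / l' * (2 * (l + l ^+ 2 / (l' - l))) * (r - 1) ^+ 2.
have K00 : 0 <= K0.
  apply: mulr_ge0 (sqr_ge0 _); apply: ltW.
  rewrite mulr_gt0 ?divr_gt0 ?mulr_gt0 // addr_gt0 // divr_gt0 ?exprn_gt0 //.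
  by rewrite subr_gt0.
pose K1 := r + 1 + (c + om) * (r + 1).
pose K2 := c ^+ 2 + 2 * om * c + 2 * om ^+ 2 + (c + om) * (r + 1) + K0
           + 2 * c * r * rho.
pose K3 := 2 * beta * rho + ((c + om) * beta) ^+ 2 * (2 / (om * c)).
pose K4 := eta ^+ 2 + ((c + om) * eta) ^+ 2 * (2 / (om * c)).
have large (K : R) : \forall t \near +oo, K <= eps * t.
  apply: filterS (nbhs_pinfty_ge (num_real (K / eps))) => t.
  by rewrite ler_pdivrMr // mulrC.
exists eps => //; near=> t => e D q g h mon_gD mon_qe lip /=.
have t1 : 1 <= t by near: t; apply: nbhs_pinfty_ge; exact: num_real.
have t0 : 0 < t by lra.
have hK1 : K1 <= eps * t by near: t.
have hK2 : K2 <= eps * t by near: t.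
have hK3 : K3 + K0 <= eps * t by near: t.
have hK4 : K4 <= eps * t by near: t.
rewrite -lerBlDl energy_step.
have D0 := dotp_ge0 D; have q0 := dotp_ge0 q.
have g0 := dotp_ge0 g; have h0 := dotp_ge0 h.
have Lip : - 2 * om * eta * t ^+ 2 * dotp g h <=
    om * eta * t ^+ 2 * dotp g g - a4 * t ^+ 2 * dotp h h
    + K0 * (dotp q q + dotp g g).
  have H := perturbed_lipschitz _ _ _ _ _ _ l0 ll' lip.
  have k0 : 0 <= om * eta / l' * t ^+ 2.
    by apply: mulr_ge0 (sqr_ge0 _); rewrite ltW // divr_gt0 // mulr_gt0.
  have {H} := ler_wpM2l k0 H.
  have -> : om * eta / l' * t ^+ 2 * (l' * dotp (g + h) (g + h) +
      2 * (l + l ^+ 2 / (l' - l)) * ((r - 1) / t) ^+ 2 * (dotp q q + dotp g g))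
      = om * eta * t ^+ 2 * (dotp g g + 2 * dotp g h + dotp h h)
        + K0 * (dotp q q + dotp g g).
    rewrite !dotpE (dotpC h g) /K0; field.
    by rewrite !gt_eqF // subr_gt0.
  rewrite /a4; lra.
have YDq : 2 * (c + om) * (r + 1) * dotp D q
    <= (c + om) * (r + 1) * (dotp D D + dotp q q).
  have k0 : 0 <= (c + om) * (r + 1) by rewrite mulr_ge0; lra.
  have := ler_wpM2l k0 (young D q 1 ltr01); rewrite invr1; lra.
have YDh : - 2 * t * eta * dotp D h
    <= t * (dotp D D + eta ^+ 2 * dotp h h).
  have := ler_wpM2l (ltW t0) (young D (- eta *: h) 1 ltr01).
  rewrite invr1 !dotpE; lra.
have k1 : 0 < om * c / 2 by rewrite divr_gt0.
have Yqz z (b : R) : - 2 * t * (c + om) * b * dotp q z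
    <= t * (om * c / 2 * dotp q q
            + ((c + om) * b) ^+ 2 * (2 / (om * c)) * dotp z z).
  have := ler_wpM2l (ltW t0) (young q (- ((c + om) * b) *: z) _ k1).
  rewrite invf_div !dotpE; lra.
have Yqg := Yqz g beta; have Yqh := Yqz h eta.
have MgD : - (2 * t * beta + 2 * om * t ^+ 2) * dotp g D
    <= (2 * t * beta + 2 * om * t ^+ 2) * rho * dotp g g.
  have k0 : 0 <= 2 * t * beta + 2 * om * t ^+ 2.
    by rewrite ltW // addr_gt0 // !mulr_gt0 // exprn_gt0.
  have := ler_wpM2l k0 mon_gD; lra.
have Mqe : 0 <= (2 * c * r - eps) * (dotp q (e + D) + rho * dotp q q).
  by apply: mulr_ge0; lra.
have BD : K1 * dotp D D + 2 * eps * t * dotp D D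
    <= eps * t * dotp D D + t * dotp D D.
  have A1 := ler_wpM2r D0 hK1.
  have A2 := ler_wpM2r (mulr_ge0 (ltW t0) D0) m1; lra.
have Bq : K2 * dotp q q + eps * t * dotp q q <= om * c * t * dotp q q.
  have A1 := ler_wpM2r q0 hK2.
  have A2 := ler_wpM2r (mulr_ge0 (ltW t0) q0) m2; lra.
have Bg : (K3 * t + K0) * dotp g g + eps * t ^+ 2 * dotp g g
    <= om * (beta - 2 * rho) * t ^+ 2 * dotp g g.
  have A1 := ler_wpM2r (mulr_ge0 (ltW t0) g0) hK3.
  have A2 := ler_wpM2r (mulr_ge0 (sqr_ge0 t) g0) m3.
  have := mulr_ge0 (mulr_ge0 K00 g0) (ltac:(lra) : 0 <= t - 1); lra.
have Bh : K4 * t * dotp h h + eps * t ^+ 2 * dotp h h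
    <= a4 * t ^+ 2 * dotp h h.
  have A1 := ler_wpM2r (mulr_ge0 (ltW t0) h0) hK4.
  have A2 := ler_wpM2r (mulr_ge0 (sqr_ge0 t) h0) m4; lra.
move: Lip YDq YDh Yqg Yqh MgD Mqe BD Bq Bg Bh.
rewrite /dissip /K1 /K2 /K3 /K4 /eta.
lra.
Unshelve. all: by end_near.
Qed.

End Energy.

(** * Convergence of real sequences *)

Section RealSequences.
Context {R : realType}.
Implicit Types (u H q : R^nat) (m l : R).

Lemma eventually_decreasing_cvg u m :
    (\forall k \near \oo, u k.+1 <= u k) -> (\forall k \near \oo, m <= u k) ->
  cvgn u.
Proof.
move=> [N1 _ dec] [N2 _ lb].
have /cvg_ex[l ul] : cvgn [sequence u (n + (N1 + N2))%N]_n.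
  apply: nonincreasing_is_cvgn.
    apply/nonincreasing_seqP => n; apply: (dec (n + (N1 + N2))%N).
    by rewrite /= addnCA leq_addr.
  exists m => _ [n _ <-]; apply: (lb (n + (N1 + N2))%N).
  by rewrite /= addnA leq_addl.
by apply/cvg_ex; exists l; rewrite -(cvg_shiftn (N1 + N2)).
Qed.

(** [a + H] is eventually nonincreasing, and it is bounded below because
    [a - H] is eventually nondecreasing and [H] is bounded. *)
Lemma dominated_increments_cvg (a : R^nat) H : cvgn H ->
    (\forall k \near \oo, `|a k.+1 - a k| <= H k - H k.+1) ->
  cvgn a.
Proof.
move=> cH [N _ inc].
have [M [_ HM]] := cvg_seq_bounded cH.
have {}HM k : - (M + 1) <= H k.
  have M1 : M < M + 1 by lra.
  have : `|H k| <= M + 1 := HM _ M1 k I.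
  by rewrite ler_norml => /andP[].
suff cS : cvgn (a + H).
  have -> : a = (a + H) - H by rewrite addrK.
  by apply: is_cvgB.
apply: (@eventually_decreasing_cvg _ (a N - H N - 2 * (M + 1))).
  exists N => // k /inc /=; rewrite /= ler_norml => /andP[_].
  by rewrite !fctE; lra.
exists N => // k /= Nk.
suff : a N - H N <= a k - H k by rewrite !fctE; have := HM k; lra.
rewrite -(subnK Nk); elim: (k - N)%N => [|i IH] //=.
have := inc (i + N)%N (leq_addl _ _).
by rewrite ler_norml addSn => /andP[+ _]; lra.
Qed.

Lemma shifted_nat_cvgpinfty (t0 : R) : (fun k : nat => k%:R + t0) @ \oo --> +oo.
Proof.
apply/cvgryPge => A; near=> k.
by rewrite -lerBlDr; near: k; exact: nbhs_infty_ger.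
Unshelve. all: by end_near. Qed.

Lemma inverse_shifted_nat_cvg0 (t0 : R) :
  (fun k : nat => (k%:R + t0)^-1) @ \oo --> 0.
Proof.
apply/gtr0_cvgV0; last exact: shifted_nat_cvgpinfty.
by have /cvgryPgt := shifted_nat_cvgpinfty t0; exact.
Qed.

(** This is a discrete form of the fact that [q] converges when
    [a q + t (dq / dt)] does.  The excess [P k] of [|q k - l / a|] over a
    threshold satisfies [P k.+1 <= (1 - a / t k) (P k)] as soon as the
    perturbation is below that threshold, and since [1 <= a] this makes
    [t k * P k] nonincreasing, so that [P] tends to 0. *)
Lemma euler_average_cvg q (t0 a : R) l : 1 <= a ->
    let t k : R := k%:R + t0 in
    (fun k => a * q k + t k * (q k.+1 - q k)) @ \oo --> l ->
  q @ \oo --> l / a.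
Proof.
move=> a1 t; set f := (f in f @ \oo --> l) => fl.
have a0 : 0 < a by lra.
have tS k : t k.+1 = t k + 1 by rewrite /t -natr1; lra.
apply/cvgrPdist_le => eps eps0.
pose P k : R := Num.max 0 (`|q k - l / a| - eps / 2).
suff : P @ \oo --> 0.
  move=> /cvgrPdist_le/(_ (eps / 2) (ltac:(lra))); apply: filterS => k.
  rewrite sub0r normrN distrC ger0_norm ?le_max ?lexx //.
  by rewrite ge_max => /andP[_]; lra.
have dec : \forall k \near \oo, t k.+1 * P k.+1 <= t k * P k.
  near=> k.
  have ta : a <= t k.
    by near: k; have /cvgryPge := shifted_nat_cvgpinfty t0; exact.
  have t0k : 0 < t k by lra.
  have fle : `|l - f k| <= a * (eps / 2).
    near: k; move/cvgrPdist_le: fl; apply.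
    by rewrite mulr_gt0 // divr_gt0.
  have qS : t k * (q k.+1 - l / a)
      = (t k - a) * (q k - l / a) - (l - f k).
    by rewrite /f; field; lra.
  have P0 : 0 <= P k by rewrite le_max lexx.
  have Pq : `|q k - l / a| <= P k + eps / 2.
    have : `|q k - l / a| - eps / 2 <= P k by rewrite le_max lexx orbT.
    lra.
  have qS_le : t k * `|q k.+1 - l / a| <= (t k - a) * P k + t k * (eps / 2).
    rewrite -[X in X * `|_|]gtr0_norm // -normrM qS.
    apply: (le_trans (ler_normB _ _)); rewrite normrM (@ger0_norm _ (t k - a)).
      have := @ler_wpM2l _ (t k - a) (ltac:(lra)) _ _ Pq.
      lra.
    by lra.
  have PS : t k * P k.+1 <= (t k - a) * P k.
    rewrite {1}/P maxEle; case: ifP => _; first by lra.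
    by rewrite mulr0 mulr_ge0 // subr_ge0.
  have PS0 : P k.+1 <= P k by rewrite -(ler_pM2l t0k); nra.
  rewrite tS; nra.
have /cvg_ex[M cM] : cvgn (fun k => t k * P k).
  apply: (eventually_decreasing_cvg _ 0 dec).
  near=> k; rewrite mulr_ge0 ?le_max ?lexx //.
  by near: k; have /cvgryPge := shifted_nat_cvgpinfty t0; exact.
have C : (fun k => t k * P k * (t k)^-1) @ \oo --> (0 : R).
  rewrite -(mulr0 M); apply: cvgM cM _; exact: inverse_shifted_nat_cvg0.
refine (cvg_trans (near_eq_cvg _) C); near=> k.
have t0k : 0 < t k.
  by near: k; have /cvgryPgt := shifted_nat_cvgpinfty t0; exact.
by rewrite mulrAC mulfV ?mul1r ?gt_eqF.
Unshelve. all: by end_near. Qed.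

End RealSequences.

(** * Convergence of the distance to a zero *)

Section Trajectory.
Context {R : realType} {p : nat}.
Variables (r om beta rho l t0 : R) (e w h : nat -> 'rV[R]_p).
Let c := (r - 2) * om.
Let eta := beta + 2 * om.
Let t (k : nat) : R := k%:R + t0.
Let D k : 'rV[R]_p := e k.+1 - e k.
Let g k : 'rV[R]_p := w k.+1 - w k.
Let U k : 'rV[R]_p := (2 * om) *: w k.+1 + beta *: g k + eta *: h k.
Let V k : 'rV[R]_p := t k *: (D k + U k).

Hypotheses (om_gt0 : 0 < om) (rho_ge0 : 0 <= rho) (rho_beta : 2 * rho < beta).
Hypotheses (r_gt2 : 2 < r) (l01 : 0 < l < 1).
Hypothesis V_rec : \forall k \near \oo,
  V k.+1 = V k - (r + 1) *: D k - c *: w k.+1.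
Hypothesis w_mono : forall k, - rho * dotp (g k) (g k) <= dotp (g k) (D k).
Hypothesis w_mono_zero : forall k,
  - rho * dotp (w k) (w k) <= dotp (w k) (e k).
Hypothesis h_lip : \forall k \near \oo, dotp (h k) (h k) <=
  l * dotp (g k + h k + ((r - 1) / t k) *: w k)
           (g k + h k + ((r - 1) / t k) *: w k).

Let E k : R := energy r om (t k) (e k) (w k) (V k).
Let diss k : R := dissip (t k) (D k) (w k.+1) (g k) (h k).
Let mono_gap k : R :=
  dotp (w k.+1) (e k.+1) + rho * dotp (w k.+1) (w k.+1).

Let t_large A : \forall k \near \oo, A <= t k.
Proof. by have /cvgryPge := @shifted_nat_cvgpinfty R t0; exact. Qed.

Let tS k : t k.+1 = t k + 1.
Proof. by rewrite /t -natr1 addrAC. Qed.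

Let eS k : e k.+1 = e k + D k.
Proof. by rewrite /D addrC subrK. Qed.

Let mono_gap_ge0 k : 0 <= mono_gap k.
Proof. by have := w_mono_zero k.+1; rewrite /mono_gap; lra. Qed.

(** The decrease also dominates [mono_gap]: the squares in [diss] alone do not
    control the products [<w k.+1, e k.+1>] in the increments studied below. *)
Lemma trajectory_descent : exists2 eps : R, 0 < eps &
  \forall k \near \oo, eps * (diss k + mono_gap k) <= E k - E k.+1.
Proof.
have [eps eps0 H] := @energy_descent R p r om beta rho l om_gt0 rho_ge0
  rho_beta r_gt2 l01.
exists eps => //.
have [N _ {}H] := shifted_nat_cvgpinfty t0 _ H.
move: (nbhs_infty_ge N) V_rec h_lip; apply: filterS3 => k /H /= Hk Vk lk.
have wk : w k = w k.+1 - g k by rewrite /g opprB addrC subrK.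
rewrite [X in ((_ / _) *: X)]wk in lk.
have := w_mono_zero k.+1; rewrite eS => mz.
have := Hk _ _ _ _ _ (w_mono k) mz lk.
rewrite /= -wk -[_ *: (D k + _)]/(V k) -Vk -eS -tS /E /diss /mono_gap; lra.
Qed.

Let dissip_ge k : 1 <= t k ->
  [/\ 0 <= t k * dotp (D k) (D k), 0 <= t k * dotp (w k.+1) (w k.+1),
      0 <= t k ^+ 2 * dotp (g k) (g k) & 0 <= t k ^+ 2 * dotp (h k) (h k)].
Proof.
move=> t1; have tk : 0 <= t k by lra.
by split; apply: mulr_ge0; rewrite ?dotp_ge0 ?sqr_ge0.
Qed.

Let diss_ge0 k : 1 <= t k -> 0 <= diss k.
Proof. by move=> /dissip_ge[? ? ? ?]; rewrite /diss /dissip !addr_ge0. Qed.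

Lemma energy_bounds_distance : \forall k \near \oo,
  r * dotp (e k) (e k) <= E k.
Proof.
near=> k; apply: (@energy_ge _ _ _ _ rho); rewrite ?w_mono_zero //.
- by move: r_gt2; lra.
- by near: k; exact: t_large.
- by rewrite -ler_pdivrMl //; near: k; exact: t_large.
Unshelve. all: by end_near. Qed.

Lemma energy_cvg : cvgn E.
Proof.
have [eps eps0 H] := trajectory_descent.
apply: (eventually_decreasing_cvg _ 0).
  near=> k.
  have t1 : 1 <= t k by near: k; exact: t_large.
  have Hk : eps * (diss k + mono_gap k) <= E k - E k.+1 by near: k.
  rewrite -subr_ge0; apply: le_trans Hk; apply: mulr_ge0; first exact: ltW.
  by rewrite addr_ge0 ?diss_ge0.
near=> k; apply: le_trans (_ : r * dotp (e k) (e k) <= _).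
  by rewrite mulr_ge0 ?dotp_ge0 //; move: r_gt2; lra.
by near: k; exact: energy_bounds_distance.
Unshelve. all: by end_near. Qed.

Lemma dissip_cvg0 : diss @ \oo --> 0.
Proof.
have [eps eps0 H] := trajectory_descent.
have /cvg_ex[M EM] := energy_cvg.
have dE : (fun k => eps^-1 * (E k - E k.+1)) @ \oo --> (0 : R).
  rewrite -(mulr0 eps^-1) -(subrr M); apply: cvgZr; apply: cvgB => //.
  by rewrite (cvg_shiftS E).
apply: squeeze_cvgr (cvg_cst 0) dE; near=> k.
have t1 : 1 <= t k by near: k; exact: t_large.
have Hk : eps * (diss k + mono_gap k) <= E k - E k.+1 by near: k.
apply/andP; split; first exact: diss_ge0.
rewrite mulrC ler_pdivlMr // mulrC; apply: le_trans Hk.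
by rewrite ler_pM2l // lerDl.
Unshelve. all: by end_near. Qed.

Let bounded_distance : exists M, \forall k \near \oo, dotp (e k) (e k) <= M.
Proof.
have [M [_ HM]] := cvg_seq_bounded energy_cvg.
exists ((M + 1) / r); near=> k.
have r0 : 0 < r by move: r_gt2; lra.
rewrite ler_pdivlMr // mulrC.
apply: le_trans (_ : E k <= _); first by near: k; exact: energy_bounds_distance.
have M1 : M < M + 1 by lra.
have : `|E k| <= M + 1 := HM _ M1 k I.
by apply: le_trans; rewrite ler_norm.
Unshelve. all: by end_near. Qed.

Let beta_gt0 : 0 < beta. Proof. by move: rho_beta rho_ge0; lra. Qed.
Let eta_gt0 : 0 < eta.
Proof. by move: beta_gt0 om_gt0; rewrite /eta; lra. Qed.
Let c_gt0 : 0 < c. Proof. by rewrite /c mulr_gt0 // subr_gt0. Qed.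

Lemma product_bounds k : 1 <= t k ->
  [/\ t k * (2 * `|dotp (D k) (w k.+1)|) <= diss k,
      t k * (2 * `|dotp (D k) (g k)|) <= diss k,
      t k * (2 * `|dotp (D k) (h k)|) <= diss k,
      t k * dotp (D k) (D k) <= diss k
    & `|dotp (w k.+1) (e k.+1)| <= mono_gap k + rho * diss k].
Proof.
move=> t1; have tk : 0 <= t k by lra.
have [d0 w0 g0 h0] := dissip_ge _ t1.
have tt (z : 'rV[R]_p) : t k * dotp z z <= t k ^+ 2 * dotp z z.
  by rewrite ler_wpM2r ?dotp_ge0 // expr2 ler_peMl.
have Y z := ler_wpM2l tk (young_norm (D k) z 1 ltr01).
have := Y (w k.+1); have := Y (g k); have := Y (h k).
have := tt (g k); have := tt (h k).
rewrite invr1 /diss /dissip; split; try lra.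
have a0 := dotp_ge0 (w k.+1).
have a1 : rho * dotp (w k.+1) (w k.+1) <= rho * (t k * dotp (w k.+1) (w k.+1)).
  by rewrite ler_wpM2l // ler_peMl.
have a2 := mulr_ge0 rho_ge0 (addr_ge0 d0 (addr_ge0 g0 h0)).
have a3 := mulr_ge0 rho_ge0 a0.
have := mono_gap_ge0 k; rewrite /mono_gap ler_norml => a4.
apply/andP; split; lra.
Qed.

Let G k : R := - (r + 1) * dotp (e k) (e k) - 2 * dotp (V k) (e k).

Lemma cross_term_cvg : cvgn G.
Proof.
have [eps eps0 H] := trajectory_descent.
pose C := r + 3 + 2 * om + beta + eta + 2 * c + 2 * c * rho.
apply: (dominated_increments_cvg _ (fun k => C / eps * E k)).
  by apply: is_cvgZr; exact: energy_cvg.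
near=> k.
have t1 : 1 <= t k by near: k; exact: t_large.
have Vk : V k.+1 = V k - (r + 1) *: D k - c *: w k.+1 by near: k.
have Hk : eps * (diss k + mono_gap k) <= E k - E k.+1 by near: k.
have [Bw Bg Bh BD Be] := product_bounds _ t1.
have D0 : 0 <= dotp (D k) (D k) := dotp_ge0 _.
have gap0 := mono_gap_ge0 k.
have diss0 : 0 <= diss k.
  by apply: le_trans BD; rewrite mulr_ge0 //; lra.
rewrite /G Vk eS cross_term_step -/c -/eta -eS.
have tk : 0 <= t k by lra.
have abs2 (a b : R) : 0 <= a ->
    `|a * (t k * (2 * b))| <= a * (t k * (2 * `|b|)).
  by move=> a0; rewrite !normrM (ger0_norm a0) (ger0_norm tk) ger0_norm.
have om2 : 0 <= 2 * om by rewrite mulr_ge0 ?ltW.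
have {}Bw := le_trans (abs2 _ _ om2) (ler_wpM2l om2 Bw).
have {}Bg := le_trans (abs2 _ _ (ltW beta_gt0)) (ler_wpM2l (ltW beta_gt0) Bg).
have {}Bh := le_trans (abs2 _ _ (ltW eta_gt0)) (ler_wpM2l (ltW eta_gt0) Bh).
have {}Be : `|2 * c * dotp (w k.+1) (e k.+1)|
    <= 2 * c * (mono_gap k + rho * diss k).
  have c2 : 0 < 2 * c by rewrite mulr_gt0.
  by rewrite normrM (gtr0_norm c2) ler_pM2l.
have BD1 : (r + 1) * dotp (D k) (D k) <= (r + 1) * diss k.
  rewrite ler_pM2l; last by move: r_gt2; lra.
  by apply: le_trans BD; rewrite ler_peMl.
have BD0 : 0 <= (r + 1) * dotp (D k) (D k).
  by rewrite mulr_ge0 //; move: r_gt2; lra.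
have tD0 : 0 <= t k * dotp (D k) (D k) by rewrite mulr_ge0 //; lra.
apply: le_trans (_ : C * (diss k + mono_gap k) <= _); last first.
  rewrite -mulrBr -mulrA; apply: ler_wpM2l; last first.
    by rewrite mulrC ler_pdivlMr // mulrC.
  rewrite /C; move: r_gt2 om_gt0 beta_gt0 eta_gt0 c_gt0.
  have := mulr_ge0 (ltW c_gt0) rho_ge0; lra.
have C0 : 0 <= (r + 3 + 2 * om + beta + eta + 2 * c * rho) * mono_gap k.
  apply: mulr_ge0 => //.
  move: r_gt2 om_gt0 beta_gt0 eta_gt0.
  have := mulr_ge0 (ltW c_gt0) rho_ge0; lra.
have C1 : 0 <= c * diss k by rewrite mulr_ge0 // ltW.
have om0 := om_gt0.
move: Bw Bg Bh Be; rewrite /C !ler_norml.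
move=> /andP[? ?] /andP[? ?] /andP[? ?] /andP[? ?].
apply/andP; split; lra.
Unshelve. all: by end_near. Qed.

Let S k : R := \sum_(0 <= i < k) 2 * dotp (e i) (U i).

(** The component of [U] along [w] is controlled by [mono_gap].  The other two
    components are only square summable against the weight [t^2], and are
    paired with [e], which is bounded: Young's inequality costs a multiple of
    [1 / t^2], dominated by the decrements of [1 / (t - 1)]. *)
Lemma correction_cvg : cvgn S.
Proof.
have [eps eps0 H] := trajectory_descent.
have [M HM] := bounded_distance.
pose C := 2 * (2 * om * (1 + rho) + om) + beta + eta.
pose K := (beta + eta) * M.
apply: (dominated_increments_cvg _
  (fun k => C / eps * E k + K * (k%:R + (t0 - 1))^-1)).
  apply: is_cvgD; first by apply: is_cvgZr; exact: energy_cvg.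
  apply: is_cvgZr; apply/cvg_ex; exists 0.
  exact: inverse_shifted_nat_cvg0.
near=> k.
have t2 : 2 <= t k by near: k; exact: t_large.
have t1 : 1 <= t k by lra.
have Hk : eps * (diss k + mono_gap k) <= E k - E k.+1 by near: k.
have Mk : dotp (e k) (e k) <= M by near: k.
have [Bw _ _ BD Be] := product_bounds _ t1.
have [d0 w0 g0 h0] := dissip_ge _ t1.
have gap0 := mono_gap_ge0 k.
have diss0 : 0 <= diss k by apply: le_trans BD.
have -> : S k.+1 - S k = 2 * dotp (e k) (U k).
  by rewrite /S big_nat_recr //= addrAC subrr add0r.
rewrite /U (correction_step _ _ _ (D k)) -/eta -eS.
have t20 : 0 < (t k ^+ 2)^-1 by rewrite invr_gt0 exprn_gt0 //; lra.
have Yz z : `|2 * dotp (e k) z| <= (t k ^+ 2)^-1 * M + t k ^+ 2 * dotp z z.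
  rewrite normrM ger0_norm //; apply: le_trans (young_norm _ _ _ t20) _.
  by rewrite invrK lerD2r ler_pM2l.
have abs2 (a b s : R) : 0 <= a -> `|b| <= s -> `|a * b| <= a * s.
  by move=> a0 bs; rewrite normrM ger0_norm // ler_wpM2l.
have om4 : 0 <= 4 * om by move: om_gt0; lra.
have Bg := abs2 _ _ _ (ltW beta_gt0) (Yz (g k)).
have Bh := abs2 _ _ _ (ltW eta_gt0) (Yz (h k)).
have {}Be := abs2 _ _ _ om4 Be.
have {Bw} : `|dotp (D k) (w k.+1)| <= diss k / 2.
  rewrite ler_pdivlMr // mulrC; apply: le_trans Bw.
  by rewrite ler_peMl // mulr_ge0.
move/(abs2 _ _ _ om4) => Bw.
have gd : beta * (t k ^+ 2 * dotp (g k) (g k)) <= beta * diss k.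
  by rewrite ler_pM2l // /diss /dissip; lra.
have hd : eta * (t k ^+ 2 * dotp (h k) (h k)) <= eta * diss k.
  by rewrite ler_pM2l // /diss /dissip; lra.
have telescope : (t k ^+ 2)^-1 <= (t k - 1)^-1 - (t k)^-1.
  have -> : (t k - 1)^-1 - (t k)^-1 = (t k * (t k - 1))^-1.
    by field; apply/andP; split; lra.
  by rewrite lef_pV2 ?posrE ?mulr_gt0 ?exprn_gt0 //; nra.
have M0 : 0 <= M by apply: le_trans Mk; exact: dotp_ge0.
have K0 : 0 <= K.
  by rewrite mulr_ge0 // addr_ge0 ?ltW.
have := ler_wpM2l K0 telescope.
have C0 : 0 <= C.
  rewrite /C; move: beta_gt0 eta_gt0 om_gt0.
  have := mulr_ge0 (ltW om_gt0) rho_ge0; lra.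
have CE : C * (diss k + mono_gap k) <= C / eps * E k - C / eps * E k.+1.
  rewrite -mulrBr -mulrA; apply: ler_wpM2l => //.
  by rewrite mulrC ler_pdivlMr // mulrC.
have -> : k%:R + (t0 - 1) = t k - 1 by rewrite /t addrA.
have -> : k.+1%:R + (t0 - 1) = t k by rewrite /t -natr1; lra.
have C1 : 0 <= (2 * (2 * om * rho + om) + beta + eta) * mono_gap k.
  apply: mulr_ge0 => //.
  move: beta_gt0 eta_gt0 om_gt0.
  have := mulr_ge0 (ltW om_gt0) rho_ge0; lra.
have C2 : 0 <= om * diss k by rewrite mulr_ge0 // ltW.
move: Bw Bg Bh Be CE; rewrite /C /K !ler_norml.
move=> /andP[? ?] /andP[? ?] /andP[? ?] /andP[? ?] ? ?.
apply/andP; split; lra.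
Unshelve. all: by end_near. Qed.

Lemma distance_cvg : cvgn (fun k => dotp (e k) (e k)).
Proof.
have /cvg_ex[lG GG] := cross_term_cvg; have /cvg_ex[lS SS] := correction_cvg.
pose Q k := dotp (e k) (e k) + S k.
have r1 : 1 <= r + 1 by move: r_gt2; lra.
have tD : (fun k => t k * dotp (D k) (D k)) @ \oo --> (0 : R).
  apply: squeeze_cvgr (cvg_cst 0) dissip_cvg0; near=> k.
  have t1 : 1 <= t k by near: k; exact: t_large.
  have [? ? ? ?] := dissip_ge _ t1.
  by have [_ _ _ -> _] := product_bounds _ t1; apply/andP.
have QQ : Q @ \oo --> ((r + 1) * lS + 0 - lG) / (r + 1).
  apply: (euler_average_cvg _ t0) => //.
  rewrite (_ : (fun k => _) =
    (fun k => (r + 1) * S k + t k * dotp (D k) (D k) - G k)).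
    by apply: cvgB GG; apply: cvgD tD; apply: cvgZr.
  apply/funext => k; rewrite -/(t k) /Q {2}/S big_nat_recr //= -/(S k) eS.
  exact: averaged_distance.
have -> : (fun k => dotp (e k) (e k)) = Q - S.
  by apply/funext => k; rewrite /Q !fctE addrK.
by apply: is_cvgB; apply/cvg_ex; eexists; [exact: QQ | exact: SS].
Unshelve. all: by end_near. Qed.

End Trajectory.

(** * Topology of the Euclidean space and Opial's lemma *)

Section EuclideanTopology.
Context {R : realType} {p : nat}.
Implicit Types (u v z : 'rV[R]_p).

Lemma norm_sqr_le_dotp u : `|u| ^+ 2 <= dotp u u.
Proof.
suff : `|u| <= enorm u.
  by move=> uu; rewrite -enorm_sqr ler_sqr ?nnegrE ?sqrtr_ge0.
rewrite -[`|u|]/(mx_norm u) mx_normrE.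
apply: bigmax_le; first exact: sqrtr_ge0.
move=> [i j] _ /=; rewrite ord1 -sqrtr_sqr ler_wsqrtr // /dotp (bigD1 j) //=.
by rewrite expr2 lerDl sumr_ge0 // => k _; rewrite -expr2 sqr_ge0.
Qed.

Lemma dotp_cvg0 (u : nat -> 'rV[R]_p) :
  (fun k => dotp (u k) (u k)) @ \oo --> (0 : R) -> u @ \oo --> (0 : 'rV[R]_p).
Proof.
move=> u0; apply/cvgr0Pnorm_le => eps eps0.
have e2 : 0 < eps ^+ 2 by rewrite exprn_gt0.
move/cvgr0Pnorm_le : u0 => /(_ _ e2); apply: filterS => k.
rewrite ger0_norm ?dotp_ge0 // => /(le_trans (norm_sqr_le_dotp _)).
by rewrite ler_sqr ?nnegrE ?normr_ge0 ?(ltW eps0).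
Qed.

Lemma cvg_dotp {I : Type} {F : set_system I} {FF : Filter F}
    (f g : I -> 'rV[R]_p) u v :
  f @ F --> u -> g @ F --> v -> (fun i => dotp (f i) (g i)) @ F --> dotp u v.
Proof.
move=> fu gv.
apply: (@cvg_big R _ +%R 0 xpredT) => [|i _]; first exact: add_continuous.
apply: cvgM.
  exact: (cvg_comp _ _ fu (@coord_continuous R 1 p 0 i u)).
exact: (cvg_comp _ _ gv (@coord_continuous R 1 p 0 i v)).
Qed.

Lemma sqdist_continuous z : continuous (fun v => dotp (v - z) (v - z)).
Proof.
move=> v; have vz : (fun v => v - z) @ v --> v - z.
  by apply: (@cvgB _ _ _ (nbhs v) _ idfun (cst z)) => //; exact: cvg_cst.
exact: (cvg_dotp _ _ _ _ vz vz).
Qed.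

Lemma closed_sqball_compact z M : compact [set v | dotp (v - z) (v - z) <= M].
Proof.
apply: bounded_closed_compact.
  exists (`|z| + (1 + M)); split; first exact: num_real.
  move=> B hB v /= vM; apply: ltW; apply: le_lt_trans hB.
  rewrite -{1}(subrK z v) addrC; apply: (le_trans (ler_normD _ _)).
  rewrite lerD2l; have := norm_sqr_le_dotp (v - z).
  have := sqr_ge0 (`|v - z| - 1); have := sqr_ge0 `|v - z|; lra.
apply: (@preimage_closed _ _ (fun v => dotp (v - z) (v - z))
  [set s | s <= M]); last exact: closed_le.
by move=> v _; exact: sqdist_continuous.
Qed.

(** By boundedness there is a cluster point [xs], which lies in [Z]; the limit
    of [|x k - xs|] exists and cannot be positive, since [x] returns
    arbitrarily close to [xs]. *)
Lemma opial (x : nat -> 'rV[R]_p) (Z : set 'rV[R]_p) : Z !=set0 ->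
    (forall z, Z z -> cvgn (fun k => dotp (x k - z) (x k - z))) ->
    cluster (x @ \oo) `<=` Z ->
  exists2 xs, Z xs & x @ \oo --> xs.
Proof.
move=> [z0 Zz0] Zcvg clusterZ.
have [M [_ HM]] := cvg_seq_bounded (Zcvg _ Zz0).
have [|xs [_ xs_cl]] := @closed_sqball_compact z0 (M + 1) (x @ \oo) _.
  exists 0%N => // k _ /=; apply: le_trans (ler_norm _) _.
  by apply: HM => //; lra.
exists xs; first exact: clusterZ.
have /cvg_ex[l ql] := Zcvg _ (clusterZ _ xs_cl).
suff l0 : l = 0.
  have : (fun k => x k - xs) @ \oo --> (0 : 'rV[R]_p).
    by apply: dotp_cvg0; rewrite -l0.
  by move/cvg_sub0; apply; exact: cvg_cst.
apply/eqP/negPn/negP => l0.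
have l_gt0 : 0 < l.
  rewrite lt_neqAle eq_sym l0 -(cvg_lim (@Rhausdorff R) ql) /=.
  apply: limr_ge; first by apply/cvg_ex; exists l.
  by near=> k; exact: dotp_ge0.
have far : \forall k \near \oo, l / 2 < dotp (x k - xs) (x k - xs).
  by apply: (cvgr_gt l) ql _ _; rewrite ltr_pdivrMr // mulr_natr mulr2n ltrDl.
have close : \forall v \near xs, dotp (v - xs) (v - xs) < l / 2.
  apply: (cvgr_lt _ (sqdist_continuous xs xs)).
  by rewrite subrr /dotp big1 ?divr_gt0 // => i _; rewrite mxE mul0r.
have [v [/= vfar vclose]] :=
  xs_cl [set v | l / 2 < dotp (v - xs) (v - xs)] _ far close.
by have := lt_trans vfar vclose; rewrite ltxx.
Unshelve. all: by end_near. Qed.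

(** Adding a limit point to the graph keeps it monotone, because the
    monotonicity inequality passes to the limit; maximality then forces the
    point to belong to the graph. *)
Lemma maximally_monotone_closed (T : setop R p) :
  maximally_monotone T -> closed (gra T).
Proof.
move=> [Tmono Tmax] [x u] clxu.
have mono_lim y v : gra T (y, v) -> 0 <= dotp (u - v) (x - y).
  move=> Tyv.
  pose f (z : 'rV[R]_p * 'rV[R]_p) := dotp (z.2 - v) (z.1 - y).
  have cf : continuous f.
    move=> z.
    have c2 : (fun z : 'rV[R]_p * 'rV[R]_p => z.2 - v) @ z --> z.2 - v.
      apply: (@cvgB R 'rV[R]_p _ (nbhs z) _ snd (cst v)); first exact: cvg_snd.
      exact: cvg_cst.
    have c1 : (fun z : 'rV[R]_p * 'rV[R]_p => z.1 - y) @ z --> z.1 - y.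
      apply: (@cvgB R 'rV[R]_p _ (nbhs z) _ fst (cst y)); first exact: cvg_fst.
      exact: cvg_cst.
    exact: (cvg_dotp _ _ _ _ c2 c1).
  have : closed (f @^-1` [set s | 0 <= s]).
    by apply: preimage_closed; [move=> z _; exact: cf | exact: closed_ge].
  move=> /(_ (x, u)); apply; apply: closureS clxu => -[a b] Tab.
  exact: Tmono Tab Tyv.
pose S : setop R p := fun a b => T a b \/ (a, b) = (x, u).
suff <- : gra S = gra T by right.
apply: Tmax => [a b c d Sab Scd|[a b] Tab]; last by left.
case: Sab Scd => [Tab|[-> ->]] [Tcd|[-> ->]] /=.
- exact: Tmono Tab Tcd.
- by rewrite -opprB -[a - x]opprB dotpNl dotpNr opprK; exact: mono_lim.
- exact: mono_lim.
- by rewrite !subrr; exact: dotp_ge0.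
Qed.

Lemma lipschitz_continuous (L : R) (F : 'rV[R]_p -> 'rV[R]_p) :
  lipschitz_euclid L F -> continuous F.
Proof.
move=> FL x; apply/(@cvgrPdist_le _ 'rV[R]_p _ _ (nbhs_filter x)) => eps eps0.
have K0 : 0 < L ^+ 2 + 1 by rewrite ltr_pwDr ?sqr_ge0.
have e2 : 0 < eps ^+ 2 / (L ^+ 2 + 1) by rewrite divr_gt0 ?exprn_gt0.
have close : \forall v \near x, dotp (v - x) (v - x) < eps ^+ 2 / (L ^+ 2 + 1).
  apply: (cvgr_lt _ (sqdist_continuous x x)).
  by rewrite subrr /dotp big1 // => i _; rewrite mxE mul0r.
move: close; apply: filterS => v vx; rewrite distrC.
rewrite -ler_sqr ?nnegrE ?normr_ge0 ?(ltW eps0) //.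
apply: le_trans (norm_sqr_le_dotp _) _.
have FLv : dotp (F v - F x) (F v - F x) <= L ^+ 2 * dotp (v - x) (v - x).
  rewrite -!enorm_sqr -exprMn ler_sqr ?nnegrE ?sqrtr_ge0 //.
  exact: le_trans (sqrtr_ge0 _) (FL v x).
move: vx; rewrite ltr_pdivlMr // => vx.
have := dotp_ge0 (v - x); lra.
Qed.

(** A pair [(x k, xi k)] is the image of [(x k, F (x k) + xi k)] under
    [(a, b) |-> (a, b - F a)], which is continuous; as the second component
    tends to 0, the pair [(xs, - F xs)] adheres to the graph. *)
Lemma cluster_zero (F : 'rV[R]_p -> 'rV[R]_p) (T : setop R p)
    (x xi : nat -> 'rV[R]_p) :
    continuous F -> closed (gra T) -> (forall k, T (x k) (xi k)) ->
    (fun k => F (x k) + xi k) @ \oo --> (0 : 'rV[R]_p) ->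
  cluster (x @ \oo) `<=` zer (sumop F T).
Proof.
move=> Fc Tc Txi w0 xs xs_cl.
exists (- F xs); last by rewrite addrN.
apply: (Tc (xs, - F xs)) => B nB.
pose phi (z : 'rV[R]_p * 'rV[R]_p) := (z.1, z.2 - F z.1).
have phi_cvg : phi @ nbhs (xs, 0 : 'rV[R]_p) --> (xs, - F xs).
  apply: (@cvg_pair _ _ _ _ (nbhs xs) (nbhs (- F xs))); first exact: cvg_fst.
  rewrite -[- F xs]add0r.
  apply: (@cvgB R 'rV[R]_p _ (nbhs (xs, 0 : 'rV[R]_p)) _ snd (F \o fst)).
    exact: cvg_snd.
  have fst_cvg : fst @ nbhs (xs, 0 : 'rV[R]_p) --> xs by exact: cvg_fst.
  exact: (cvg_comp _ _ fst_cvg (Fc xs)).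
have [[A1 A2] /= [nA1 nA2] subA] := phi_cvg _ nB.
have near_A2 : \forall k \near \oo, A2 (F (x k) + xi k) by exact: w0.
have [|a [[k A2k <-] A1k]] :=
    xs_cl [set x k | k in [set k | A2 (F (x k) + xi k)]] A1 _ nA1.
  by apply: filterS near_A2 => k A2k; exists k.
exists (x k, xi k); split; first exact: Txi.
have := subA (x k, F (x k) + xi k) (conj A1k A2k).
by rewrite /phi /= addrAC subrr add0r.
Qed.

End EuclideanTopology.

(** * From the scheme to the velocity recursion *)

Section Iterates.
Context {R : realType} {p : nat}.
Variables (F : 'rV[R]_p -> 'rV[R]_p) (T : setop R p) (r beta eta : R).
Variables (t : nat -> R) (x y xi : nat -> 'rV[R]_p).
Hypotheses (eta_neq0 : eta != 0) (scheme : AEG F T r beta eta t x y xi).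
Let om := omega beta eta.
Let w k := w_ F x xi k.
Let h k := what_ F y xi k.+1 - w k.+1.

(** All occurrences of [y] are eliminated; the parameters of the scheme are
    chosen so that the coefficients of [what] recombine into [V k] and only
    multiples of the displacement and of [w k.+1] remain. *)
Lemma AEG_velocity_step k : t k.+1 = t k + 1 -> t k != 0 -> t k.+1 != 0 ->
  let V k := t k *: (x k.+1 - x k
    + ((2 * om) *: w k.+1 + beta *: (w k.+1 - w k) + eta *: h k)) in
  V k.+1 = V k - (r + 1) *: (x k.+1 - x k) - ((r - 2) * om) *: w k.+1.
Proof.
move=> tS tk tk1 /=.
rewrite (AEG_xE eta_neq0 scheme k.+1) (AEG_y scheme k) /d_ /h.
move: (what_ F y xi k.+2) (what_ F y xi k.+1) => a2 a1.
rewrite -!/(w _); move: (w k.+2) (w k.+1) (w k) => w2 w1 w0.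
move: (x k.+1) (x k) => x1 x0.
apply/rowP => i; rewrite !mxE.
rewrite /theta_ /eta_ /gamma_ /lambda_ /nu_ /delta_ /om /omega tS.
by rewrite tS in tk1; field; rewrite ?tk ?tk1.
Qed.

Lemma AEG_displacement k : t k != 0 ->
  y k = x k.+1 + eta *: ((w k.+1 - w k) + h k + ((r - 1) / t k) *: w k).
Proof.
move=> tk; rewrite (AEG_xE eta_neq0 scheme k) /d_ -/(w k) /h.
move: (what_ F y xi k.+1) (w k.+1) (w k) (y k) => a1 w1 w0 y0.
by apply/rowP => i; rewrite !mxE /gamma_; field.
Qed.

(** [h k = F (y k) - F (x k.+1)], so the displacement formula turns the
    Lipschitz condition into a bound of [h k] by [w k.+1 - w k], [h k] itself
    and a small multiple of [w k]. *)
Lemma AEG_forward_error (L : R) k : lipschitz_euclid L F -> t k != 0 ->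
  dotp (h k) (h k) <= (L * eta) ^+ 2 *
    dotp ((w k.+1 - w k) + h k + ((r - 1) / t k) *: w k)
         ((w k.+1 - w k) + h k + ((r - 1) / t k) *: w k).
Proof.
move=> FL tk; set d := _ + _ *: w k.
have -> : h k = F (y k) - F (x k.+1).
  by rewrite /h /w /w_ /what_ /= opprD addrACA subrr addr0.
have yx : y k - x k.+1 = eta *: d.
  by rewrite (AEG_displacement _ tk) addrC addKr.
have := FL (y k) (x k.+1); rewrite yx => Fd.
have : enorm (F (y k) - F (x k.+1)) ^+ 2 <= (L * enorm (eta *: d)) ^+ 2.
  by rewrite ler_sqr ?nnegrE ?sqrtr_ge0 //; exact: le_trans (sqrtr_ge0 _) Fd.
rewrite exprMn !enorm_sqr dotpZl dotpZr => /le_trans; apply.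
by rewrite exprMn; lra.
Qed.

End Iterates.

(** * Convergence of the iterates *)

Theorem theorem7p3 (R : realType) (p : nat)
    (F : 'rV[R]_p -> 'rV[R]_p) (T : 'rV[R]_p -> set 'rV[R]_p)
    (L rho r beta eta : R)
    (x y xi : nat -> 'rV[R]_p)
    (hL : 0 < L) (hrho : 0 <= rho)
    (hzer : zer (sumop F T) !=set0)
    (hF : lipschitz_euclid L F)
    (hPhi : co_hypomonotone rho (sumop F T))
    (hLrho : 2 * L * rho < 1)
    (hr : 2 < r)
    (hbeta : 2 * rho < beta) (hbetaeta : beta < eta) (heta : eta < L^-1)
    (hJ : single_valued_everywhere (resolvent eta T))
    (hT : closed (gra T) \/ maximally_monotone T)
    (hAEG : AEG F T r beta eta (tseq L rho r beta eta) x y xi) :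
  exists xstar : 'rV[R]_p,
    [/\ zer (sumop F T) xstar,
        x k @[k --> \oo] --> xstar
      & y k @[k --> \oo] --> xstar].
Proof.
have eta0 : 0 < eta by lra.
have eta_neq0 : eta != 0 by rewrite gt_eqF.
have {}hT : closed (gra T) by case: hT => // /maximally_monotone_closed.
pose om := omega beta eta.
have om0 : 0 < om by rewrite /om /omega; lra.
have etaE : beta + 2 * om = eta by rewrite /om /omega; field.
have l01 : 0 < (L * eta) ^+ 2 < 1.
  have Le0 : 0 < L * eta by rewrite mulr_gt0.
  have Le1 : L * eta < 1 by rewrite mulrC -ltr_pdivlMr // mul1r.
  by rewrite exprn_gt0 //= exprn_ilt1 // ltW.
pose t0 := t_init L rho r beta eta.
pose t k : R := k%:R + t0.
have {}hAEG : AEG F T r beta eta t x y xi := hAEG.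
have tS k : t k.+1 = t k + 1 by rewrite /t -natr1 addrAC.
have t_large (A : R) : \forall k \near \oo, A <= t k.
  by have /cvgryPge := @shifted_nat_cvgpinfty R t0; exact.
pose w k := w_ F x xi k.
pose h k : 'rV[R]_p := what_ F y xi k.+1 - w k.+1.
have Txi := AEG_xiP eta_neq0 hAEG.
have Phi_w k : gra (sumop F T) (x k, w k).
  by exists (xi k) => /=; [exact: Txi | ].
have w_mono k : - rho * dotp (w k.+1 - w k) (w k.+1 - w k)
    <= dotp (w k.+1 - w k) (x k.+1 - x k).
  by rewrite -enorm_sqr; apply: hPhi.
have w_mono_zero z : zer (sumop F T) z ->
    forall k, - rho * dotp (w k) (w k) <= dotp (w k) (x k - z).
  move=> z0 k; have := hPhi (x k) (w k) z 0 (Phi_w k) z0.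
  by rewrite subr0 enorm_sqr.
have V_rec : \forall k \near \oo,
  let V k := t k *: (x k.+1 - x k
    + ((2 * om) *: w k.+1 + beta *: (w k.+1 - w k) + eta *: h k)) in
  V k.+1 = V k - (r + 1) *: (x k.+1 - x k) - ((r - 2) * om) *: w k.+1.
  near=> k.
  have t1 : 1 <= t k by near: k; exact: t_large.
  by apply: (AEG_velocity_step F T r beta eta t x y xi eta_neq0 hAEG) => //;
    rewrite gt_eqF // ?tS; lra.
have h_lip : \forall k \near \oo, dotp (h k) (h k) <= (L * eta) ^+ 2 *
    dotp ((w k.+1 - w k) + h k + ((r - 1) / t k) *: w k)
         ((w k.+1 - w k) + h k + ((r - 1) / t k) *: w k).
  near=> k.
  have t1 : 1 <= t k by near: k; exact: t_large.
  apply: (AEG_forward_error F T r beta eta t x y xi eta_neq0 hAEG) => //.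
  by rewrite gt_eqF //; lra.
have traj z (zz : zer (sumop F T) z) :
    cvgn (fun k => dotp (x k - z) (x k - z)) /\
    (fun k => dissip (t k) (x k.+1 - x k) (w k.+1) (w k.+1 - w k) (h k))
      @ \oo --> (0 : R).
  have De k : x k.+1 - z - (x k - z) = x k.+1 - x k.
    by rewrite opprB addrA subrK.
  have V_rec' : \forall k \near \oo,
    let V k := t k *: (x k.+1 - z - (x k - z)
      + ((2 * om) *: w k.+1 + beta *: (w k.+1 - w k)
         + (beta + 2 * om) *: h k)) in
    V k.+1 = V k - (r + 1) *: (x k.+1 - z - (x k - z))
             - ((r - 2) * om) *: w k.+1.
    by move: V_rec; apply: filterS => k /=; rewrite !De etaE.
  have w_mono' k : - rho * dotp (w k.+1 - w k) (w k.+1 - w k)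
      <= dotp (w k.+1 - w k) (x k.+1 - z - (x k - z)) by rewrite De.
  split.
    exact: (distance_cvg r om beta rho ((L * eta) ^+ 2) t0
      (fun k => x k - z) w h om0 hrho hbeta hr l01 V_rec' w_mono'
      (w_mono_zero z zz) h_lip).
  under eq_fun => k do rewrite -De.
  exact: (dissip_cvg0 r om beta rho ((L * eta) ^+ 2) t0
      (fun k => x k - z) w h om0 hrho hbeta hr l01 V_rec' w_mono'
      (w_mono_zero z zz) h_lip).
have [z0 zz0] := hzer; have [_ diss0] := traj _ zz0.
pose diss k := dissip (t k) (x k.+1 - x k) (w k.+1) (w k.+1 - w k) (h k).
have diss_le k : 1 <= t k ->
    [/\ dotp (w k.+1) (w k.+1) <= diss k,
        dotp (w k.+1 - w k) (w k.+1 - w k) <= diss k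
      & dotp (h k) (h k) <= diss k].
  move=> t1; have tk : 0 <= t k by lra.
  have t2 : 1 <= t k ^+ 2 by rewrite expr_ge1.
  have grow a (v : 'rV[R]_p) : 1 <= a -> dotp v v <= a * dotp v v :> R.
    by move=> a1; rewrite ler_peMl ?dotp_ge0.
  have A := mulr_ge0 tk (dotp_ge0 (x k.+1 - x k)).
  have := grow _ (w k.+1) t1; have := grow _ (w k.+1 - w k) t2.
  have := grow _ (h k) t2.
  have := dotp_ge0 (w k.+1); have := dotp_ge0 (w k.+1 - w k).
  have := dotp_ge0 (h k); rewrite /diss /dissip; split; lra.
have small (v : nat -> 'rV[R]_p) :
    (forall k, 1 <= t k -> dotp (v k) (v k) <= diss k) ->
    v @ \oo --> (0 : 'rV[R]_p).
  move=> v_le; apply: dotp_cvg0; apply: squeeze_cvgr (cvg_cst 0) diss0.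
  near=> k; rewrite dotp_ge0 v_le //; near: k; exact: t_large.
have w0 : w @ \oo --> (0 : 'rV[R]_p).
  by rewrite -(cvg_shiftS w); apply: small => k /diss_le[].
have g0 : (fun k => w k.+1 - w k) @ \oo --> (0 : 'rV[R]_p).
  by apply: small => k /diss_le[].
have h0 : h @ \oo --> (0 : 'rV[R]_p) by apply: small => k /diss_le[].
have [xs zxs x_cvg] : exists2 xs, zer (sumop F T) xs & x @ \oo --> xs.
  apply: opial => //; first by move=> z /traj[].
  apply: (@cluster_zero _ _ F T x xi) => //; exact: lipschitz_continuous hF.
exists xs; split => //.
have tau0 : (fun k => (r - 1) / t k) @ \oo --> (0 : R).
  rewrite -(mulr0 (r - 1)); apply: cvgZr; exact: inverse_shifted_nat_cvg0.
have : (fun k =>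
      x k.+1 + eta *: ((w k.+1 - w k) + h k + ((r - 1) / t k) *: w k))
    @ \oo --> xs + eta *: (0 + 0 + 0 *: (0 : 'rV[R]_p)).
  apply: cvgD; first by rewrite (cvg_shiftS x).
  by apply: cvgZr; apply: cvgD; [exact: cvgD | exact: cvgZ].
rewrite scale0r !addr0 scaler0 addr0; apply: cvg_trans.
apply: near_eq_cvg; near=> k.
have t1 : 1 <= t k by near: k; exact: t_large.
rewrite (AEG_displacement F T r beta eta t x y xi eta_neq0 hAEG) //.
by rewrite gt_eqF //; lra.
Unshelve. all: by end_near. Qed.
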